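(* Let $p$ be a minimal idempotent in $(\beta\mathbb{N}, +)$, let $\langle B_n \rangle_{n=1}^\infty$ be a sequence of members of $p$, let $\langle A_n \rangle_{n=1}^\infty$ be a sequence of kernel partition regular matrices with entries from $\mathbb{Q}$, and let $m_n$ be the number of columns of $A_n$. Then for each $n \in \mathbb{N}$ there exists $\vec{x}_n \in \mathbb{N}^{m_n}$ with $A_n \vec{x}_n = \vec{0}$ such that for every nonempty finite $F \subseteq \mathbb{N}$, $\sum_{n \in F} Y_n \subseteq B_{\min F}$, where $Y_n$ denotes the set of entries of $\vec{x}_n$.
   Context: $\beta\mathbb{N}$ is the set of ultrafilters on $\mathbb{N}$ with the extension of addition $p+q = \{A \subseteq \mathbb{N} : \{x : -x+A \in q\} \in p\}$, $-x+A=\{y: x+y\in A\}$, a compact right topological semigroup. A minimal idempotent is an idempotent in the smallest two-sided ideal $K(\beta\mathbb{N})$. A finite $u\times v$ matrix $A$ with rational entries is kernel partition regular (over $\mathbb{N}$) if for every finite coloring of $\mathbb{N}$ there exists $\vec{x}\in\mathbb{N}^v$ whose entries all have the same color and $A\vec{x}=\vec{0}$. For finite $F \subseteq \mathbb{N}$ and nonempty sets $Y_n$, $\sum_{n \in F} Y_n = \{\sum_{n \in F} a_n : a_n \in Y_n \text{ for each } n \in F\}$. *)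

(* Defs.v *)
From mathcomp Require Import all_boot all_order all_algebra.
Set Implicit Arguments. Unset Strict Implicit. Unset Printing Implicit Defensive.
Import Order.TTheory GRing.Theory Num.Theory.

Definition Npos (n : nat) : Prop := (0 < n)%N.

Definition nset := nat -> Prop.

(* p is an ultrafilter on N = {1,2,...} (viewed as a family of subsets of nat
   containing the set of positive integers). *)
Definition is_ultrafilter (p : nset -> Prop) : Prop :=
  [/\ p Npos,
      ~ p (fun _ => False),
      (forall A B : nset, p A -> (forall x, A x -> B x) -> p B),
      (forall A B : nset, p A -> p B -> p (fun x => A x /\ B x))
    & (forall A : nset, p A \/ p (fun x => ~ A x))].

Definition shiftset (x : nat) (A : nset) : nset := fun y => A (x + y)%N.

Definition uplus (p q : nset -> Prop) : nset -> Prop :=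
  fun A => p (fun x => q (shiftset x A)).

Definition two_sided_ideal (I : (nset -> Prop) -> Prop) : Prop :=
  [/\ (forall p, I p -> is_ultrafilter p),
      (exists p, I p)
    & (forall p q, I p -> is_ultrafilter q -> I (uplus p q) /\ I (uplus q p))].

(* membership in the smallest two-sided ideal K(beta N): belonging to every
   two-sided ideal (K exists since beta N is a compact right topological
   semigroup, so K is the intersection of all ideals) *)
Definition in_K (p : nset -> Prop) : Prop :=
  is_ultrafilter p /\ forall I, two_sided_ideal I -> I p.

Definition minimal_idempotent (p : nset -> Prop) : Prop :=
  is_ultrafilter p /\ uplus p p = p /\ in_K p.

Definition kernel_PR (u v : nat) (A : 'M[rat]_(u, v)) : Prop :=
  forall (k : nat) (c : nat -> 'I_k),
    exists x : 'I_v -> nat,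
      [/\ forall j, (0 < x j)%N,
          (forall j j', c (x j) = c (x j')) &
          (forall i : 'I_u, \sum_(j < v) (A i j * (x j)%:R)%R = 0 :> rat)%R].

Definition seqmin (F : seq nat) : nat := \big[minn/head 0%N F]_(n <- F) n.

(* Main.v *)
Require Import Defs.
From mathcomp Require Import all_boot all_order all_algebra.
From mathcomp Require Import boolp classical_sets filter.
From mathcomp Require Import zify.
Import GRing.Theory Num.Theory.
Set Implicit Arguments. Unset Strict Implicit. Unset Printing Implicit Defensive.

(** Call a set rich if for finitely many sequences [f_i] in N it contains all
    the points [a + sum_(n in H) f_i n] for some [a] and one nonempty finite [H].
    Colour focusing shows that some class of every finite colouring of N is rich,
    so there are ultrafilters with only rich members; these form a two-sided
    ideal, hence every minimal idempotent [p] is one of them.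

    By Rado's argument a kernel partition regular matrix satisfies the columns
    condition, so its kernel contains an echelon family of vectors.  Solutions
    with entries in a member of [p] are then built level by level: the solution
    for the levels treated so far can be repeated along a sequence all of whose
    finite sums stay in the given set, and richness supplies the next level.
    The same construction of a sequence with controlled finite sums, applied to
    the given matrices, proves the theorem. *)

(** * Colour focusing for translates of finite sums *)

Definition line_point (f : nat -> nat) (a : nat) (H : seq nat) : nat :=
  a + \sum_(n <- H) f n.

Lemma line_pointD f a a' H H' :
  line_point f (a + a') (H ++ H') = line_point f a H + line_point f a' H'.
Proof. by rewrite /line_point big_cat addnACA. Qed.

Lemma line_pointDl f a z H : line_point f (a + z) H = line_point f a H + z.
Proof. by rewrite /line_point addnAC. Qed.

Lemma leq_sum_range (f : nat -> nat) (H : seq nat) m M :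
  uniq H -> all (fun n => m <= n < M) H ->
  \sum_(n <- H) f n <= \sum_(0 <= n < M) f n.
Proof.
move=> uH /allP hH.
have pH : perm_eq H [seq n <- index_iota 0 M | n \in H].
  apply: uniq_perm => //; first by rewrite filter_uniq ?iota_uniq.
  move=> n; rewrite mem_filter mem_index_iota /=.
  by case: (boolP (n \in H)) => //= /hH /andP[_ ->].
rewrite (perm_big _ pH) big_filter big_mkcond /=.
by apply: leq_sum => n _; case: ifP.
Qed.

(** The points stay below [M], so a palette that records the colours of offsets below [M] sees all
    of them; the lower bound [m] allows two index sets to be kept disjoint. *)
Definition mono_line (T : Type) (c : nat -> T) (f : nat -> nat -> nat)
    (r m M a : nat) (H : seq nat) : Prop :=
  [/\ H != [::], uniq H, all (fun n => m <= n < M) H &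
      forall i, i <= r ->
        line_point (f i) a H < M /\
        c (line_point (f i) a H) = c (line_point (f 0) a H)].

(** Each round either finds a line for [f 0], ..., [f r.+1] or adds a colour to the list of lines
    sharing the focus [z]. Once [s] exceeds the number of colours, only the first case remains. *)
Lemma color_focus (f : nat -> nat -> nat) (r : nat) (T : finType) :
  (forall (S : finType) m, exists M, forall c : nat -> S,
     exists a H, mono_line c f r m M a H) ->
  forall s m, exists M, forall c : nat -> T,
    (exists a H, mono_line c f r.+1 m M a H) \/
    exists z chis, [/\ z < M, size chis = s, uniq chis &
      forall chi, chi \in chis -> exists a H,
        [/\ mono_line c f r m M a H, line_point (f r.+1) a H = z
          & c (line_point (f 0) a H) = chi]].
Proof.
move=> IH; elim=> [|s IHs] m.
  by exists 1 => c; right; exists 0, [::].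
have [M1 h1] := IHs m.
(* A point is coloured by the pattern of [c] on the block of length [M1] starting there; outer
   indices are at least [m + M1] to avoid the inner ones. *)
have [M2 h2] := IH {ffun 'I_M1 -> T} (m + M1).
set M := M1 + M2 + \sum_(0 <= n < M2) f r.+1 n.
have M2M : M1 + M2 <= M by apply: leq_addr.
exists M => c.
have [a [H [H0 uH hH line]]] := h2 (fun x => [ffun z : 'I_M1 => c (x + z)]).
have col i z : i <= r -> z < M1 ->
    c (line_point (f i) a H + z) = c (line_point (f 0) a H + z).
  move=> /line[_ /ffunP e] zM; have := e (Ordinal zM).
  by rewrite !ffunE.
have foc z : z < M1 -> line_point (f r.+1) a H + z < M.
  move=> zM; have := leq_sum_range (f r.+1) uH hH.
  have [a_lt _] := line 0 isT.
  move: a_lt; rewrite /line_point /M; set S := \sum_(_ <- H) f 0 _.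
  by lia.
have hHM : all (fun n => m <= n < M) H.
  by apply: sub_all hH => n /=; lia.
have cat_ok (H' : seq nat) : H' != [::] -> uniq H' -> all (fun n => m <= n < M1) H' ->
    [/\ H ++ H' != [::], uniq (H ++ H') & all (fun n => m <= n < M) (H ++ H')].
  move=> H'0 uH' hH'; split.
  - by case: (H) H0.
  - rewrite cat_uniq uH uH' andbT /=; apply/hasPn => n /(allP hH') /= hn.
    by apply/negP => /(allP hH) /=; lia.
  - by rewrite all_cat hHM /=; apply: sub_all hH' => n /=; lia.
set x := line_point (f 0) a H in col *.
have xM : x < M2 by case: (line 0 isT).
have lift a' H' : mono_line (fun z => c (x + z)) f r.+1 m M1 a' H' ->
    mono_line c f r.+1 m M (x + a') H'.
  case=> H'0 uH' hH' line'; split=> //.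
    by apply: sub_all hH' => n /=; lia.
  move=> i /line'[lt_i eq_i]; rewrite !(addnC x) !line_pointDl !(addnC _ x).
  by split; [lia | exact: eq_i].
have [[a' [H' /lift L]]|[z [chis [zM szc uc hc]]]] := h1 (fun z => c (x + z)).
  by left; exists (x + a'), H'.
(* If the colour of the inner focus is already listed, the focus completes that line. Otherwise the
   outer line translated by [z] carries the new colour, and the old lines are concatenated with the
   outer one to share the new focus. *)
have [/hc[a' [H' [[H'0 uH' hH' line'] foc' col']]]|chi0] :=
    boolP (c (x + z) \in chis).
  left; exists (x + a'), H'; apply: lift; split=> // i.
  rewrite leq_eqVlt => /predU1P[->|]; last by rewrite ltnS => /line'.
  by rewrite foc'; split; last rewrite col'.
right; exists (line_point (f r.+1) a H + z), (c (x + z) :: chis); split.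
- exact: foc.
- by rewrite /= szc.
- by rewrite /= chi0.
move=> chi; rewrite inE => /predU1P[->|/hc[a' [H' [[H'0 uH' hH' line'] foc' col']]]].
  exists (a + z), H; rewrite !line_pointDl -/x; split=> //; split=> // i ir.
  rewrite !line_pointDl; split; last exact: col.
  by have [] := line i ir; lia.
exists (a + a'), (H ++ H'); rewrite !line_pointD foc' -/x; split=> //.
have [? ? ?] := cat_ok H' H'0 uH' hH'.
split=> // i ir; rewrite !line_pointD.
have [lt_i eq_i] := line' i ir; have [lt_i' _] := line i ir.
by split; [lia | rewrite col // eq_i].
Qed.

(* A van der Waerden theorem for translates of finite sums: the bound [M] must
   not depend on the colouring, so that in the induction the palette can be
   enlarged to all colourings of an initial segment. *)
Lemma ip_van_der_Waerden r (f : nat -> nat -> nat) (T : finType) m :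
  exists M, forall c : nat -> T, exists a H, mono_line c f r m M a H.
Proof.
elim: r T m => [|r IHr] T m.
  exists (m + f 0 m).+1 => c; exists 0, [:: m]; split=> //.
    by rewrite /= andbT; lia.
  by move=> i; rewrite leqn0 => /eqP ->; rewrite /line_point big_seq1; split=> //; lia.
have [M hM] := color_focus T IHr #|T|.+1 m; exists M => c.
have [//|[z [chis [_ szc uc _]]]] := hM c.
by have := max_card [in chis]; rewrite (card_uniqP uc) szc ltnn.
Qed.

(** * Ultrafilters on the positive integers *)

Section Ultrafilters.
Variable q : nset -> Prop.
Hypothesis uq : is_ultrafilter q.

Lemma uf_sub (A B : nset) : q A -> (forall x, A x -> B x) -> q B.
Proof. by case: uq => _ _ h _ _; apply: h. Qed.

Lemma uf_and (A B : nset) : q A -> q B -> q (fun x => A x /\ B x).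
Proof. by case: uq => _ _ _ h _; apply: h. Qed.

Lemma uf_ex (A : nset) : q A -> exists x, A x.
Proof.
move=> qA; apply: contrapT => nA; case: uq => _ q0 _ _ _; apply: q0.
by apply: uf_sub qA _ => x Ax; apply: nA; exists x.
Qed.

Lemma uf_true (A : nset) : (forall x, A x) -> q A.
Proof. by move=> hA; case: uq => /uf_sub h *; apply: h => x _. Qed.

Lemma uf_all (T : eqType) (s : seq T) (A : T -> nset) :
  (forall t, t \in s -> q (A t)) -> q (fun x => forall t, t \in s -> A t x).
Proof.
elim: s => [|t s IHs] hs; first by apply: uf_true.
have /IHs qs u : u \in s -> q (A u) by move=> us; apply: hs; rewrite inE us orbT.
apply: uf_sub (uf_and (hs t (mem_head _ _)) qs) _ => x [At As] u.
by rewrite inE => /predU1P[->|/As].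
Qed.

Lemma uf_color n (c : nat -> nat) :
  (forall x, c x < n) -> exists2 i, i < n & q (fun x => c x = i).
Proof.
move=> cn; apply: contrapT => hn.
have hi i : i \in iota 0 n -> q (fun x => c x <> i).
  rewrite mem_iota => /= lt_in; case: uq => _ _ _ _ /(_ (fun x => c x = i))[] //.
  by move=> qi; case: hn; exists i.
have [x /(_ (c x))] := uf_ex (uf_all hi).
by rewrite mem_iota cn; apply.
Qed.

End Ultrafilters.

Lemma uplus_ultrafilter q r :
  is_ultrafilter q -> is_ultrafilter r -> is_ultrafilter (uplus q r).
Proof.
move=> uq ur; split.
- have [qN _ _ _ _] := uq; apply: (uf_sub uq qN) => x x0.
  by apply: uf_true => // y; rewrite /shiftset /Npos addn_gt0; apply/orP; left.
- by move=> /(uf_ex uq)[x] /(uf_ex ur)[].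
- move=> A B qA AB; apply: (uf_sub uq qA) => x rA.
  by apply: (uf_sub ur rA) => y; apply: AB.
- move=> A B qA qB; apply: (uf_sub uq (uf_and uq qA qB)) => x [rA rB].
  by apply: (uf_sub ur (uf_and ur rA rB)).
move=> A; case: (uq) => _ _ _ _ /(_ (fun x => r (shiftset x A)))[]; first by left.
move=> h; right; apply: (uf_sub uq h) => x nr.
by case: ur => _ _ _ _ /(_ (shiftset x A))[].
Qed.

(** * Rich sets and the smallest ideal *)

Definition ip_rich (C : nset) : Prop :=
  forall (f : nat -> nat -> nat) r, exists a H,
    [/\ H != [::], uniq H & forall i, i <= r -> C (line_point (f i) a H)].

(** Colouring by membership in a set that is not rich puts its complement into the filter [F] below,
    so an ultrafilter refining [F] has only rich members. Colour focusing makes [F] proper. *)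
Lemma ip_rich_ultrafilter :
  exists2 q, is_ultrafilter q & forall C, q C -> ip_rich C.
Proof.
pose mono (T : finType) (c : nat -> T) (f : nat -> nat -> nat) r a H :=
  [/\ H != [::], uniq H & forall i, i <= r ->
      c (line_point (f i) a H) = c (line_point (f 0) a H)].
(* [A] contains every colour class that contains a line for [f]. *)
pose F (A : set nat) := exists (T : finType) (c : nat -> T) f r,
  forall a H, mono T c f r a H -> forall x, c x = c (line_point (f 0) a H) -> A x.
have F_ex A : F A -> exists x, A x.
  case=> T [c [f [r h]]].
  have [M /(_ c)[a [H [H0 uH _ hm]]]] := ip_van_der_Waerden r f T 0.
  exists (line_point (f 0) a H); apply: h => //; split=> // i /hm.
  by case.
have FF : ProperFilter F.
  split; first by move=> /F_ex[].
  split.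
  - by exists unit, (fun=> tt), (fun _ _ => 0), 0.
  - move=> A B [T [c [f [r hA]]]] [T' [c' [f' [r' hB]]]].
    (* A line for the concatenated families, monochromatic for the product colouring, serves
       both. *)
    pose g i := if i <= r then f i else f' (i - r.+1).
    have gl i : i <= r -> g i = f i by rewrite /g => ->.
    have gr i : g (i + r.+1) = f' i by rewrite /g addnK ifN // -ltnNge; lia.
    exists (T * T')%type, (fun x => (c x, c' x)), g, (r + r'.+1) => a H [H0 uH hm].
    move=> x []; rewrite gl // => cx c'x; split.
      apply: hA cx; split=> // i ir; have := hm i (leq_trans ir (leq_addr _ _)).
      by rewrite !gl //; case.
    have hm' i : i <= r' -> c' (line_point (f' i) a H) = c' (line_point (f 0) a H).
      move=> ir; have ir' : i + r.+1 <= r + r'.+1 by lia.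
      by have := hm _ ir'; rewrite gr gl // => -[].
    by apply: hB (etrans c'x (esym (hm' 0 isT))); split=> // i ir; rewrite !hm'.
  - move=> A B AB [T [c [f [r h]]]]; exists T, c, f, r => a H hm x cx.
    exact/AB/(h a H hm).
have [q [qU Fq]] := ultraFilterLemma FF.
have uq : is_ultrafilter q.
  split.
  - apply: Fq; exists bool, (leq 1), (fun _ _ => 1), 0 => a [|n H] [H0 uH hm] x //.
    by rewrite /Npos /line_point big_cons addnCA => ->.
  - exact: filter_not_empty.
  - by move=> A B qA AB; apply: filterS qA.
  - by move=> A B; apply: filterI.
  - by move=> A; have [|h] := in_ultra_setVsetC A qU; [left | right].
exists q => // C qC f r; apply: contrapT => nC.
suff qnC : q (~` C)%classic.
  by have [x []] := uf_ex uq (uf_and uq qC qnC).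
apply: Fq; exists bool, (fun x => `[< C x >]), f, r => a H [H0 uH hm] x eqx Cx.
apply: nC; exists a, H; split=> // i ir.
by apply/asboolP; rewrite hm // -eqx; apply/asboolP.
Qed.

Lemma minimal_ip_rich p C : in_K p -> p C -> ip_rich C.
Proof.
case=> _ /(_ (fun q => is_ultrafilter q /\ forall C, q C -> ip_rich C)) h pC.
suff /h[_] : two_sided_ideal (fun q => is_ultrafilter q /\ forall C, q C -> ip_rich C).
  exact.
split; first by move=> q [].
  by have [q uq rq] := ip_rich_ultrafilter; exists q.
move=> q r [uq rq] ur; split; split; try exact: uplus_ultrafilter.
  (* For [uplus q r]: only finitely many points are involved, so a single [y] serves them all. *)
  move=> D /rq rich f s; have [a [H [H0 uH hH]]] := rich f s.
  have [y hy] : exists y, forall i, i \in iota 0 s.+1 -> D (line_point (f i) a H + y).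
    by apply/(uf_ex ur)/(uf_all ur) => i; rewrite mem_iota ltnS => /hH.
  exists (a + y), H; split=> // i ir; rewrite line_pointDl.
  by apply: hy; rewrite mem_iota ltnS.
(* For [uplus r q]: some shift of [D] is rich, and the line is translated back. *)
move=> D /(uf_ex ur)[x /rq rich] f s; have [a [H [H0 uH hH]]] := rich f s.
by exists (x + a), H; split=> // i /hH; rewrite /line_point /shiftset addnA.
Qed.

(** * Finite sums along an idempotent *)

Lemma seqmin_eq (n : nat) (F : seq nat) :
  n \in F -> (forall k, k \in F -> n <= k) -> seqmin F = n.
Proof.
move=> nF leF; rewrite /seqmin.
have lb x k : k \in F -> \big[minn/x]_(i <- F) i <= k.
  elim: (F) => // y s IHs; rewrite big_cons inE => /predU1P[->|/IHs h].
    exact: geq_minl.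
  exact: leq_trans (geq_minr _ _) h.
have ub x : n <= x -> n <= \big[minn/x]_(i <- F) i.
  move=> nx; rewrite big_seq; elim/big_ind: _ => // a b na nb.
  by rewrite leq_min na.
apply/eqP; rewrite eqn_leq lb //= ub // leF //.
by case: (F) nF => //= y s _; apply: mem_head.
Qed.

Section Idempotent.
Variable p : nset -> Prop.
Hypothesis up : is_ultrafilter p.
Hypothesis pp : uplus p p = p.

Definition star (C : nset) : nset := fun x => C x /\ p (shiftset x C).

Lemma star_in C : p C -> p (star C).
Proof. by move=> pC; have := pC; rewrite -{1}pp; apply: (uf_and up pC). Qed.

(** Shifting by [x] and then by [y] is shifting by [x + y]. This closure is what lets sums be
    prolonged indefinitely. *)
Lemma star_shift C x : star C x -> p (shiftset x (star C)).
Proof.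
move=> [_ /star_in ps]; apply: (uf_sub up ps) => y [Cy py]; split=> //.
by apply: (uf_sub up py) => z; rewrite /shiftset addnA.
Qed.

(** The residue [i] whose class belongs to [p] satisfies [i + i = i] modulo [d], hence is zero. *)
Lemma idempotent_dvdn d : 0 < d -> p (fun x => d %| x).
Proof.
move=> d0; have [i id pi] := uf_color up (fun x => ltn_pmod x d0).
have pi2 : uplus p p (fun x => x %% d = i) by rewrite pp.
have [x [xi px]] := uf_ex up (uf_and up pi pi2).
have [y [yi]] := uf_ex up (uf_and up pi px).
rewrite /shiftset => xyi; apply: (uf_sub up pi) => z zi.
have : x + y = x + 0 %[mod d] by rewrite addn0 xyi xi.
by move/eqP; rewrite eqn_modDl mod0n yi -zi.
Qed.

(** Solutions are chosen one after another in shrinking members [C n] of [p]. The abstract [X], [P],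
    [E] allow two uses: for partial echelon solutions and for the given matrices. *)
Lemma finite_sums_in (X : Type) (P : nat -> X -> Prop) (E : nat -> X -> seq nat)
    (B : nat -> nset) :
  (forall n, p (B n)) ->
  (forall n C, p C -> exists x, P n x /\ forall y, y \in E n x -> C y) ->
  exists x : nat -> X, (forall n, P n (x n)) /\
    forall (F : seq nat) (a : nat -> nat), F != [::] -> uniq F ->
      (forall n, n \in F -> a n \in E n (x n)) ->
      B (seqmin F) (\sum_(n <- F) a n).
Proof.
move=> pB solve.
have [pick pickP] : {pick : nat * nset -> X & forall nC, p nC.2 ->
    P nC.1 (pick nC) /\ forall y, y \in E nC.1 (pick nC) -> nC.2 y}.
  apply: (@choice _ _ (fun nC x => p nC.2 ->
    P nC.1 x /\ forall y, y \in E nC.1 x -> nC.2 y)).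
  move=> [n C]; have [pC|npC] := pselect (p C).
    by have [x hx] := solve n C pC; exists x.
  (* Outside [p] any value will do; this one shows that [X] is inhabited. *)
  by exists (sval (cid (solve 0 _ (pB 0)))).
pose sol n C := pick (n, star C).
(* Later sums must remain in [star C] when an entry chosen at stage [n] is added. *)
pose next n C : nset := fun z => B n.+1 z /\ star C z /\
  forall y, y \in E n (sol n C) -> star C (y + z).
pose C := fix C n : nset := if n is m.+1 then next m (C m) else B 0.
have solP n : p (C n) -> P n (sol n (C n)) /\
    forall y, y \in E n (sol n (C n)) -> star (C n) y.
  by move=> /star_in pC; apply: (pickP (n, star (C n))).
have pC n : p (C n).
  elim: n => //= n pCn; have [_ solCn] := solP n pCn.
  apply: (uf_and up) => //; apply: (uf_and up); first exact: star_in.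
  by apply: (uf_all up) => y /solCn/star_shift.
have CB n : forall x, C n x -> B n x by case: n => // n x [].
have Cdec m n : m <= n -> forall x, C n x -> C m x.
  elim: n => [|n IHn]; first by rewrite leqn0 => /eqP ->.
  rewrite leq_eqVlt => /predU1P[->//|/IHn mn x [_ [[Cx _] _]]]; exact: mn.
exists (fun n => sol n (C n)); split=> [n|F a F0 uF aE]; first by have [] := solP n (pC n).
(* The sum is assembled from its largest index down. *)
have inC n s : path ltn n s -> (forall k, k \in n :: s -> a k \in E k (sol k (C k))) ->
    star (C n) (\sum_(k <- n :: s) a k).
  elim: s n => [|k s IHs] n.
    by move=> _ h; rewrite big_seq1; have [_] := solP n (pC n); apply; apply/h/mem_head.
  move=> /= /andP[nk ks] h; rewrite big_cons.
  have [Ck _] := IHs k ks (fun j js => h j (mem_behead (js : j \in behead (n :: k :: s)))).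
  have [_ [_]] := Cdec n.+1 k nk _ Ck; apply; exact/h/mem_head.
have : perm_eq (sort leq F) F by rewrite perm_sort.
have : sorted ltn (sort leq F) by rewrite ltn_sorted_uniq_leq sort_uniq uF sort_sorted.
case: (sort leq F) => [_|n s path_s perm_s].
  by rewrite perm_sym => /perm_nilP F_nil; rewrite F_nil in F0.
have -> : seqmin F = n.
  apply: seqmin_eq => [|k]; first by rewrite -(perm_mem perm_s) mem_head.
  rewrite -(perm_mem perm_s) inE => /predU1P[->//|ks].
  by have /allP/(_ k ks)/ltnW := order_path_min ltn_trans path_s.
rewrite -(perm_big _ perm_s); apply: CB; case: (inC n s path_s) => // k.
by rewrite (perm_mem perm_s) => /aE.
Qed.

End Idempotent.

(** * Echelon systems inside members of a minimal idempotent *)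

Lemma intr_nat (R : pzRingType) (n : nat) : (n%:Z%:~R = n%:R :> R)%R.
Proof. by []. Qed.

Lemma common_denominator (I : finType) (r : I -> rat) :
  exists2 N, 0 < N & forall i, exists z : int, (z%:~R = N%:R * r i :> rat)%R.
Proof.
exists (\prod_i `|denq (r i)|%N) => [|i].
  by rewrite prodn_gt0 // => i; rewrite absz_gt0 denq_neq0.
exists ((\prod_(k | k != i) `|denq (r k)|%N)%:Z * numq (r i))%R.
rewrite [in RHS](bigD1 i) //= intrM natrM intr_nat mulrAC [RHS]mulrC.
congr (_ * _)%R.
by rewrite -intr_nat absz_denq mulrC -numqE.
Qed.

Lemma dvdn_clear_denominator (N y : nat) (r : rat) :
  (exists z : int, (z%:~R = N%:R * r :> rat)%R) -> N %| y ->
  exists z : int, (z%:~R = y%:R * r :> rat)%R.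
Proof.
move=> [z hz] /dvdnP[k ->]; exists (k%:Z * z)%R.
by rewrite intrM hz natrM mulrA intr_nat.
Qed.

(** Induction on the number of levels: a sum over [H] of solutions for the lower levels is again
    one. For a column of the new level, [y t] and [y t] plus its lower-level value are points of two
    lines with the same [a] and [H], which richness puts into [C]. *)
Lemma echelon_solvable p (J : finType) (g : J -> nat) (b : nat -> J -> rat) :
  minimal_idempotent p ->
  (forall j, b (g j) j = 1%R) -> (forall s j, g j < s -> b s j = 0%R) ->
  forall t C, p C -> exists y : nat -> nat, (forall s, s < t -> C (y s)) /\
    forall j, g j < t ->
      exists2 n, C n & (n%:R = \sum_(s < t) (y s)%:R * b s j :> rat)%R.
Proof.
move=> [up [pp pK]] b1 b0; elim=> [|t IHt] C pC; first by exists id.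
(* Coefficients divisible by [N] give every column an integral value. *)
have [N N0 hN] := common_denominator (fun sj : 'I_t * J => b sj.1 sj.2).
pose C' x := C x /\ N %| x.
have pC' : p C' by apply: (uf_and up) => //; apply: idempotent_dvdn.
pose val (y : nat -> nat) j := (\sum_(s < t) (y s)%:R * b s j : rat)%R.
pose P (n : nat) (x : (nat -> nat) * (J -> nat)) :=
  forall j, g j < t -> ((x.2 j)%:R = val x.1 j)%R.
pose E (n : nat) (x : (nat -> nat) * (J -> nat)) :=
  [seq x.1 s | s <- iota 0 t] ++ [seq x.2 j | j <- enum J & g j < t].
have solve n D : p D -> exists x, P n x /\ forall y, y \in E n x -> D y.
  move=> /IHt[y [Dy hy]].
  have /choice[z hz] j : exists n, g j < t -> D n /\ (n%:R = val y j)%R.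
    by case: (ltnP (g j) t) => [/hy[k]|]; [exists k | exists 0].
  exists (y, z); split=> [j /hz[]//|w].
  rewrite mem_cat => /orP[] /mapP[s hs ->] /=.
    by apply: Dy; move: hs; rewrite mem_iota.
  by move: hs; rewrite mem_filter => /andP[/hz[]].
have [x [Px sums]] := finite_sums_in up pp (fun=> pC') solve.
have in1 n s : s < t -> (x n).1 s \in E n (x n).
  by move=> st; rewrite mem_cat map_f // mem_iota.
have in2 n j : g j < t -> (x n).2 j \in E n (x n).
  by move=> jt; rewrite mem_cat (map_f (x n).2) ?orbT // mem_filter jt mem_enum.
have [f hf] : exists f : nat -> J -> int, forall n j, ((f n j)%:~R = val (x n).1 j)%R.
  have /choice[f hf] (nj : nat * J) : exists z : int, (z%:~R = val (x nj.1).1 nj.2)%R.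
    case: nj => n j /=.
    have div s : s < t -> N %| (x n).1 s.
      move=> st; have := sums [:: n] (fun=> (x n).1 s) isT isT.
      rewrite big_seq1; case=> // k; rewrite inE => /eqP ->; exact: in1.
    have /fin_all_exists[z hz] (s : 'I_t) :
        exists z : int, (z%:~R = ((x n).1 s)%:R * b s j :> rat)%R.
      exact: dvdn_clear_denominator (hN (s, j)) (div s (ltn_ord s)).
    by exists (\sum_s z s)%R; rewrite rmorph_sum /=; apply: eq_bigr => s _.
  by exists (fun n j => f (n, j)) => n j; apply: hf (n, j).
(* [G n] outweighs negative values, so [h j] differs from [G] by exactly the column value. *)
pose G n := \sum_j `|f n j|%N.
pose h j n := absz ((G n)%:Z + f n j)%R.
have hE j n : ((h j n)%:R = (G n)%:R + val (x n).1 j :> rat)%R.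
  have G_ge : `|f n j|%N <= G n by rewrite /G (bigD1 j) //= leq_addr.
  by rewrite -hf -intr_nat gez0_abs ?intrD ?intr_nat //; lia.
(* The family lists the [h j]; index [#|J|] falls on the default [G]. *)
have [a [H [H0 uH line]]] := minimal_ip_rich pK pC' (nth G [seq h j | j <- enum J]) #|J|.
have {line} [Cline_G Cline_h] : C' (line_point G a H) /\ forall j, C' (line_point (h j) a H).
  split=> [|j]; first by have := line _ (leqnn _); rewrite nth_default // size_map -cardE.
  have := line (index j (enum J)); rewrite (nth_map j) ?nth_index ?mem_enum //.
    by apply; rewrite cardE index_size.
  by rewrite index_mem mem_enum.
pose Y s := \sum_(n <- H) (x n).1 s.
pose y s := if s < t then Y s else line_point G a H.
have yt s : s < t -> y s = Y s by rewrite /y => ->.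
have ytt : y t = line_point G a H by rewrite /y ltnn.
have valY j : (val y j = \sum_(n <- H) val (x n).1 j)%R.
  rewrite /val exchange_big; apply: eq_bigr => s _ /=.
  by rewrite yt // natr_sum mulr_suml.
exists y; split=> [s|j]; rewrite ltnS leq_eqVlt => /predU1P[].
- by move=> ->; rewrite ytt; case: Cline_G.
- move=> st; rewrite yt //.
  by have [] := sums H (fun n => (x n).1 s) H0 uH (fun n _ => in1 n s st).
- move=> jt; exists (line_point (h j) a H); first by case: (Cline_h j).
  rewrite big_ord_recr /= -/(val y j) valY ytt -jt b1 mulr1 !natrD !natr_sum.
  by rewrite (eq_bigr _ (fun n _ => hE j n)) big_split /= addrA addrC.
- move=> jt; exists (\sum_(n <- H) (x n).2 j).
    by have [] := sums H (fun n => (x n).2 j) H0 uH (fun n _ => in2 n j jt).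
  rewrite big_ord_recr /= -/(val y j) valY b0 // mulr0 addr0 natr_sum.
  by apply: eq_bigr => n _; apply: Px.
Qed.

(** * The columns condition *)

Lemma column_sum_alternative (u v : nat) (A : 'M[rat]_(u, v)) (J I : {set 'I_v}) :
  [disjoint I & J] ->
  (exists b : 'I_v -> rat,
     [/\ forall j, j \in I -> b j = 1%R,
         forall j, j \notin I -> j \notin J -> b j = 0%R &
         forall i, (\sum_j A i j * b j = 0)%R]) \/
  (exists R : 'I_v -> int,
     [/\ forall j, j \in J -> R j = 0%R, (\sum_(j in I) R j != 0)%R &
         forall x : 'I_v -> rat, (forall i, \sum_j A i j * x j = 0)%R ->
           (\sum_j (R j)%:~R * x j = 0)%R]).
Proof.
move=> dIJ.
pose s : 'rV[rat]_u := (\row_i \sum_(j in I) A i j)%R.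
pose M : 'M[rat]_(v, u) := (\matrix_(j, i) if j \in J then A i j else 0)%R.
(* Either the sum of the columns in [I] lies in the span of the columns in [J], or a functional,
   found as a column of the cokernel, vanishes on that span but not on the sum. *)
have [/submxP[d sd]|] := boolP (s <= M)%MS.
  left; exists (fun j => if j \in I then 1 else if j \in J then - d ord0 j else 0)%R.
  split=> [j ->//|j /negPf-> /negPf->//|i].
  have := congr1 (fun m : 'rV_u => m ord0 i) sd; rewrite !mxE.
  rewrite big_mkcond => /eqP; rewrite -subr_eq0 -sumrB => /eqP eq0.
  rewrite -[RHS]eq0;  apply: eq_bigr => j _; rewrite mxE; case: ifP => jI.
    by rewrite (disjointFr dIJ jI) mulr1 mulr0 subr0.
  by case: ifP; rewrite ?mulr0 ?subr0 // mulrN sub0r mulrC.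
rewrite submxE => /eqP sM; right.
have [k sk] : exists k, (s *m cokermx M)%R ord0 k != 0%R.
  apply: contrapT => nk; apply/sM/matrixP => i k; rewrite ord1 [RHS]mxE.
  by apply/eqP; apply: contrapT => /negP sk; apply: nk; exists k.
pose r j := (\sum_i A i j * cokermx M i k)%R.
have rJ j : j \in J -> r j = 0%R.
  move=> jJ; have := mulmx_coker M => /matrixP/(_ j k); rewrite !mxE => <-.
  by apply: eq_bigr => i _; rewrite ?mxE jJ.
have rI : (\sum_(j in I) r j = (s *m cokermx M) ord0 k)%R.
  by rewrite exchange_big [RHS]mxE; apply: eq_bigr => i _; rewrite [s _ _]mxE mulr_suml.
have [N N0 /fin_all_exists[R hR]] := common_denominator r.
exists R; split.
- by move=> j /rJ rj; apply/eqP; rewrite -(intr_eq0 rat) hR rj mulr0.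
- rewrite -(intr_eq0 rat) rmorph_sum /= (eq_bigr _ (fun j _ => hR j)) -mulr_sumr rI.
  by rewrite mulf_neq0 // pnatr_eq0 -lt0n.
move=> x Ax; under eq_bigr do rewrite hR -mulrA mulr_suml.
rewrite -mulr_sumr exchange_big /= big1 ?mulr0 // => i _.
under eq_bigr do rewrite mulrAC.
by rewrite -mulr_suml Ax mul0r.
Qed.

(* Rado: colour by the last nonzero digit in a large prime base [q]; in a
   monochromatic solution the columns are ordered by the [q]-adic valuations of
   the unknowns. *)
Lemma kernel_PR_columns (u v : nat) (A : 'M[rat]_(u, v)) : kernel_PR A ->
  exists (e : 'I_v -> nat) (b : nat -> 'I_v -> rat),
    [/\ forall j, b (e j) j = 1%R,
        forall t j, t < e j -> b t j = 0%R &
        forall t i, (\sum_j A i j * b t j = 0)%R].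
Proof.
move=> hA.
pose good (JI : {set 'I_v} * {set 'I_v}) (R : 'I_v -> int) :=
  [/\ forall j, j \in JI.1 -> R j = 0%R, (\sum_(j in JI.2) R j != 0)%R &
      forall x : 'I_v -> rat, (forall i, \sum_j A i j * x j = 0)%R ->
           (\sum_j (R j)%:~R * x j = 0)%R].
(* Relations are fixed for all pairs in advance: the prime must be chosen before the colouring,
   hence before [J] and [I] are known. *)
have /fin_all_exists[R hR] JI : exists R, (exists R', good JI R') -> good JI R.
  have [[R hR]|n] := pselect (exists R', good JI R'); first by exists R.
  by exists (fun=> 0%R).
have [q qS q_pr] :=
  prime_above (\sum_(JI : {set 'I_v} * {set 'I_v}) absz (\sum_(j in JI.2) R JI j)%R).
have q0 := prime_gt0 q_pr.
have digit_lt x : (x %/ q ^ logn q x) %% q < q by rewrite ltn_mod.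
have [x [x0 cx Ax]] := hA q (fun x => Ordinal (digit_lt x)).
pose e j := logn q (x j).
suff hb t : exists b : 'I_v -> rat,
    [/\ forall j, e j = t -> b j = 1%R, forall j, t < e j -> b j = 0%R &
        forall i, (\sum_j A i j * b j = 0)%R].
  have [b {}hb] := choice hb; exists e, b.
  split=> [j|t'|t']; [have [b1 _ _] := hb (e j); exact: b1 | |]; by have [] := hb t'.
pose J := [set j | e j < t]; pose I := [set j | e j == t].
have dIJ : [disjoint I & J].
  by apply/pred0P => j; rewrite /= !inE; lia.
have [[b [b1 b0 Ab]]|/(hR (J, I))] := column_sum_alternative A dIJ.
  exists b; split=> // j; first by move=> jt; apply: b1; rewrite inE jt.
  by move=> tj; apply: b0; rewrite inE; lia.
set S := R (J, I); case=> /= SJ SI /(_ _ Ax) Sx; exfalso.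
have {Sx} Sx : (\sum_j S j * (x j)%:Z = 0)%R.
  apply/eqP; rewrite -(intr_eq0 rat) rmorph_sum /=; apply/eqP.
  by rewrite -[RHS]Sx; apply: eq_bigr => j _; rewrite intrM.
have S_lt : absz (\sum_(j in I) S j)%R < q.
  by apply: leq_ltn_trans qS; rewrite (bigD1 (J, I)) //= leq_addr.
have [j1 j1I] : exists j, j \in I.
  apply/existsP; rewrite -[[exists _, _]]negbK negb_exists; apply: contraNN SI.
  by move=> /forallP hI; apply/eqP/big_pred0 => j; apply/negbTE/hI.
pose d := (x j1 %/ q ^ e j1) %% q.
have xE j : (x j = (x j %/ q ^ e j) * q ^ e j)%N by rewrite divnK // pfactor_dvdnn.
have dE j : (x j %/ q ^ e j) %% q = d by have /(congr1 val) := cx j j1.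
have qd : ~~ (q %| d).
  rewrite /dvdn modn_mod -/(dvdn _ _); apply/negP => qx.
  have := dvdn_mul qx (dvdnn (q ^ e j1)); rewrite -xE -expnS pfactor_dvdn //.
  by rewrite ltnn.
(* Modulo [q ^ t.+1] only valuation [t] contributes: [S] vanishes on smaller valuations, and larger
   ones give multiples. *)
have : ((q ^ t.+1)%:Z %| ((\sum_(j in I) S j) * (d * q ^ t)%N%:Z)%R)%Z.
  rewrite -[X in (_ %| X)%Z]subr0 -[X in (_ - X)%R]Sx mulr_suml big_mkcond -sumrB /=.
  elim/big_ind: _ => [|a a'|j _]; [exact: dvdz0 | exact: rpredD|].
  have [ej|ej|ej] := ltngtP (e j) t.
  - by rewrite inE ltn_eqF // SJ ?inE // mul0r subr0.
  - rewrite inE gtn_eqF // sub0r rpredN; apply: dvdz_mull.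
    by rewrite dvdzE /=; apply: dvdn_trans (dvdn_exp2l q ej) (pfactor_dvdnn _ _).
  - have := xE j; have := dE j; rewrite inE ej eqxx.
    set m := x j %/ q ^ t => md ->; rewrite -mulrBr -opprB mulrN rpredN dvdz_mull //.
    by rewrite (divn_eq m q) md mulnDl PoszD addrK -mulnA -expnS PoszM dvdz_mull.
(* After cancelling [q ^ t], the prime would divide a nonzero integer of absolute value below
   [q]. *)
rewrite expnS !PoszM mulrA dvdz_mul2r ?eqz_nat -?lt0n ?expn_gt0 ?q0 //.
rewrite dvdzE abszM Euclid_dvdM // (negPf qd) orbF => /dvdn_leq.
by rewrite absz_gt0 => /(_ SI); rewrite leqNgt S_lt.
Qed.

(** * Kernel solutions in members of a minimal idempotent, and the theorem *)

Lemma minimal_kernel_solution p (u v : nat) (A : 'M[rat]_(u, v)) C :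
  minimal_idempotent p -> kernel_PR A -> p C ->
  exists x : 'I_v -> nat, (forall j, C (x j)) /\
    forall i, (\sum_j A i j * (x j)%:R = 0 :> rat)%R.
Proof.
move=> hp /kernel_PR_columns[e [b [b1 b0 Ab]]] pC.
pose K := \max_j e j.
have eK j : e j <= K by apply: leq_bigmax.
(* Levels are reversed: [b] vanishes before the level of a column, while [echelon_solvable] wants
   zeros after it. *)
pose b' s j := if s <= K then b (K - s) j else 0%R.
have b'1 j : b' (K - e j) j = 1%R by rewrite /b' leq_subr subKn.
have b'0 s j : K - e j < s -> b' s j = 0%R.
  by move=> js; rewrite /b'; case: ifP => // sK; apply: b0; have := eK j; lia.
have Ab' s i : (\sum_j A i j * b' s j = 0)%R.
  rewrite /b'; case: (s <= K); first exact: Ab.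
  by apply: big1 => j _; rewrite mulr0.
have [y [_ hy]] := echelon_solvable hp b'1 b'0 K.+1 pC.
have /fin_all_exists2[x Cx xE] j : exists2 n, C n &
    (n%:R = \sum_(s < K.+1) (y s)%:R * b' s j :> rat)%R.
  by apply: hy; rewrite ltnS leq_subr.
exists x; split=> // i; under eq_bigr do rewrite xE mulr_sumr.
rewrite exchange_big big1 // => s _; under eq_bigr do rewrite mulrCA.
by rewrite -mulr_sumr Ab' mulr0.
Qed.

Theorem theorem2p2
  (p : nset -> Prop) (hp : minimal_idempotent p)
  (B : nat -> nset) (hB : forall n, (0 < n)%N -> p (B n))
  (u v : nat -> nat) (A : forall n, 'M[rat]_(u n, v n))
  (hA : forall n, (0 < n)%N -> kernel_PR (A n)) :
  exists x : forall n, 'I_(v n) -> nat,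
    (forall n, (0 < n)%N ->
       (forall j, (0 < x n j)%N) /\
       (forall i : 'I_(u n), (\sum_(j < v n) A n i j * (x n j)%:R = 0 :> rat)%R)) /\
    (forall F : seq nat, F != [::] -> uniq F -> all (fun n => 0 < n)%N F ->
       forall a : nat -> nat,
         (forall n, n \in F -> exists j : 'I_(v n), a n = x n j) ->
         B (seqmin F) (\sum_(n <- F) a n)%N).
Proof.
have [up [pp _]] := hp; have [pN _ _ _ _] := up.
(* Index 0 is outside the theorem, so every condition is made vacuous there. *)
pose B' n x := 0 < n -> B n x.
have pB' n : p (B' n).
  case: n => [|n]; first by apply: (uf_true up).
  by apply: (uf_sub up (hB n.+1 isT)) => x Bx _.
pose P n (x : nat -> nat) := 0 < n -> (forall j : 'I_(v n), 0 < x j) /\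
  forall i, (\sum_(j < v n) A n i j * (x j)%:R = 0 :> rat)%R.
pose E n (x : nat -> nat) := if 0 < n then [seq x j | j <- iota 0 (v n)] else [::].
have solve n C : p C -> exists x, P n x /\ forall y, y \in E n x -> C y.
  rewrite /P /E => pC; case: (posnP n) => [_|n0]; first by exists id.
  have [x [Cx Ax]] := minimal_kernel_solution hp (hA n n0) (uf_and up pC pN).
  (* Extension by 0 to all of [nat] gives vectors a type independent of [n]. *)
  pose x' k := if insub k is Some j then x j else 0.
  have x'E (j : 'I_(v n)) : x' j = x j by rewrite /x' valK.
  exists x'; split=> [_|y /mapP[k]].
    split=> [j|i]; first by rewrite x'E; have [] := Cx j.
    by under eq_bigr do rewrite x'E.
  rewrite mem_iota => /= kv ->; rewrite -[k]/(val (Ordinal kv)) x'E.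
  by have [] := Cx (Ordinal kv).
have [x [Px sums]] := finite_sums_in up pp pB' solve.
exists (fun n j => x n j); split=> [n /Px//|F F0 uF /allP posF a aE].
have F_min : seqmin F \in F.
  case: F F0 {uF posF aE} => // n F _; rewrite /seqmin.
  rewrite big_seq; elim/big_ind: _ => [|k l kF lF|] //; first exact: mem_head.
  by rewrite /minn; case: ifP.
apply: sums => // [n nF|]; last exact: posF.
have [j ->] := aE n nF; rewrite /E posF //.
by apply: map_f; rewrite mem_iota ltn_ord.
Qed.
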